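(* Let $a,b\ge 2$ be integers with $\gcd(a,b)=1$ and $a$ odd. Then the sequence $(\Gamma(a,b^i))_{i=1}^\infty$ is periodic with the period dividing $\mathrm{ord}_a(b)$.
   Context: For coprime positive integers $a,b$, it is known that exactly one of the two equations $ax+by=\frac{(a-1)(b-1)}{2}$ and $1+ax+by=\frac{(a-1)(b-1)}{2}$ has a solution in nonnegative integers $x,y$. Define $\Gamma(a,b)=0$ if the first equation has such a solution, and $\Gamma(a,b)=1$ if the second does. $\mathrm{ord}_a(b)$ denotes the multiplicative order of $b$ modulo $a$. *)

(* Defs.v *)
From mathcomp Require Import all_boot all_algebra all_fingroup cyclic.
From mathcomp Require Import zify.
Set Implicit Arguments.
Unset Strict Implicit.
Unset Printing Implicit Defensive.

(* For coprime a and b at least one of them is odd, so the halving is exact. *)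
Definition half_prod (a b : nat) : nat := (a.-1 * b.-1)./2.

(* Solvability of c + a x + b y = (a - 1)(b - 1) / 2 in natural numbers.  For
   a, b > 0 the bounds on x and y are harmless: see solvableP. *)
Definition solvable (c a b : nat) : bool :=
  [exists x : 'I_(half_prod a b).+1, exists y : 'I_(half_prod a b).+1,
     c + a * x + b * y == half_prod a b].

(* Meant for coprime a, b > 0, where exactly one of the equations with c = 0
   and c = 1 is solvable: see Gamma0P and Gamma1P. *)
Definition Gamma (a b : nat) : nat := if solvable 0 a b then 0 else 1.

(* The order of the class of b in the unit group of Z/aZ, for 1 < a and
   coprime a b; outside this domain it has no meaning.  See mult_order_dvd. *)
Definition mult_order (a b : nat) : nat :=
  #[insubd (1%g : {unit 'Z_a}) (b%:R : 'Z_a)%R]%g.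

Definition is_period (T : Type) (u : nat -> T) (p : nat) : Prop :=
  0 < p /\ forall i, u (i + p) = u i.

Definition least_period (T : Type) (u : nat -> T) (p : nat) : Prop :=
  is_period u p /\ forall q, is_period u q -> p <= q.

Lemma solvableP (c a b : nat) : 0 < a -> 0 < b ->
  reflect (exists x y : nat, c + a * x + b * y = (a.-1 * b.-1)./2)
          (solvable c a b).
Proof.
move=> a0 b0; apply: (iffP existsP) => [[x /existsP[y /eqP e]]|[x [y e]]].
  by exists x, y.
have lx : x < (half_prod a b).+1 by rewrite /half_prod -e; nia.
have ly : y < (half_prod a b).+1 by rewrite /half_prod -e; nia.
by exists (Ordinal lx); apply/existsP; exists (Ordinal ly); apply/eqP.
Qed.

Lemma half_prodK (a b : nat) : coprime a b ->
  (half_prod a b).*2 = a.-1 * b.-1.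
Proof.
move=> co; rewrite /half_prod -[RHS]odd_double_half oddM.
suff -> : odd a.-1 && odd b.-1 = false by [].
apply/negP => /andP[oa ob].
have : 2 %| gcdn a b by rewrite dvdn_gcd; apply/andP; split; lia.
by rewrite (eqP co).
Qed.

Lemma solvable_dichotomy (a b : nat) : 0 < a -> 0 < b -> coprime a b ->
  solvable 1 a b = ~~ solvable 0 a b.
Proof.
move=> a0 b0 co; have e2 := half_prodK co.
apply/idP/idP.
  move/(solvableP _ a0 b0) => [x [y e]]; apply/negP.
  move/(solvableP _ a0 b0) => [x' [y' e']].
  rewrite -/(half_prod a b) in e e'.
  have E : a * (x + x' + 1) + b * (y + y' + 1) = a * b.
    by case: a b a0 b0 {co} e e' e2 => [|a] [|b] //=; lia.
  have : b %| x + x' + 1.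
    have cb : coprime b a by rewrite coprime_sym.
    by rewrite -(Gauss_dvdr _ cb) -(dvdn_addl _ (dvdn_mulr (y + y' + 1) (dvdnn b)))
               E dvdn_mull.
  move/dvdn_leq => /(_ ltac:(lia)) le.
  have {}le : a * b <= a * (x + x' + 1) by rewrite leq_mul2l le orbT.
  have : 0 < b * (y + y' + 1) by rewrite muln_gt0 b0 addn1.
  by lia.
move=> H; apply/(solvableP _ a0 b0); rewrite -/(half_prod a b).
set N := half_prod a b in e2 *.
have [x lx ex] : exists2 x, x < b & a * x = N %[mod b].
  have /dvdnP[q eq] : a %| chinese a b 0 N by rewrite /dvdn chinese_modl // mod0n.
  exists (q %% b); first by rewrite ltn_pmod.
  by rewrite modnMmr mulnC -eq chinese_modr.
case: (leqP (a * x) N) => [le|lt].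
  case/negP: H; apply/(solvableP _ a0 b0); rewrite -/(half_prod a b) -/N.
  move/esym/eqP: ex; rewrite eqn_mod_dvd // => /dvdnP[k ek].
  by exists x, k; rewrite add0n [b * k]mulnC -ek subnKC.
move/eqP: ex; rewrite eqn_mod_dvd ?(ltnW lt) // => /dvdnP[k ek].
exists (b.-1 - x), k.-1.
have k0 : 0 < k by case: k ek => [|//]; lia.
have [z ez] : exists z, b = (x + z).+1 by exists (b - x.+1); lia.
clearbody N; rewrite {}ez /= addKn in e2 ek *.
by case: a k a0 {b0 co H lx} e2 lt ek k0 => [|a] [|k] //=; lia.
Qed.

Lemma Gamma0P (a b : nat) : 0 < a -> 0 < b ->
  Gamma a b = 0 <-> exists x y : nat, a * x + b * y = (a.-1 * b.-1)./2.
Proof.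
by move=> a0 b0; rewrite /Gamma; case: (solvableP 0 a0 b0).
Qed.

Lemma Gamma1P (a b : nat) : 0 < a -> 0 < b -> coprime a b ->
  Gamma a b = 1 <-> exists x y : nat, 1 + a * x + b * y = (a.-1 * b.-1)./2.
Proof.
move=> a0 b0 co; rewrite /Gamma.
have := rwP (solvableP 1 a0 b0); rewrite solvable_dichotomy //.
by case: (solvable 0 a b) => /= -[h1 h2]; split=> // h; [move: (h1 h) | exact: h2].
Qed.

Lemma mult_order_dvd (a b k : nat) : 1 < a -> coprime a b ->
  (mult_order a b %| k) = (b ^ k == 1 %[mod a]).
Proof.
move=> a1 co; rewrite /mult_order order_dvdn -val_eqE FinRing.val_unitX.
rewrite val_insubd unitZpE // co -GRing.natrX -val_eqE /=.
by rewrite val_Zp_nat // Zp_cast.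
Qed.

(* Main.v *)
Require Import Defs.
From mathcomp Require Import all_boot.
From mathcomp Require Import fingroup zify.

(** For odd [a = 2h + 1], whether [a x + b y = (a - 1)(b - 1) / 2] is solvable
    depends only on [b] modulo [a].  Indeed the right-hand side is [h (b - 1)],
    so in a solution [y <= h], and the substitution [t = h - y] turns the
    equation into [b t = h + a x].  Conversely, if [t <= h] and [b t] is
    congruent to [h] modulo [a], then [b t] is automatically at least [h],
    because [h < a]; so [x] is a natural number.  Solvability thus means that
    some [t <= h] satisfies [b t = h %[mod a]] (lemma [solvable0_modP]).

    Hence [Gamma a (b ^ i)] depends only on [b ^ i] modulo [a], and the order
    of [b] modulo [a] is a period of the sequence.  A sequence with decidable
    equality and some period has a least one, which divides every period
    (lemma [least_period_dvd]). *)

Lemma is_period_mul (T : Type) (u : nat -> T) (p k i : nat) :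
  is_period u p -> u (i + k * p) = u i.
Proof.
move=> [_ up]; elim: k => [|k IHk]; first by rewrite addn0.
by rewrite mulSn addnCA addnC up.
Qed.

Lemma least_period_dvd (T : eqType) (u : nat -> T) (n : nat) :
  is_period u n -> exists2 p, least_period u p & p %| n.
Proof.
move=> un; have [n0 unE] := un.
(* Being a period can be tested on the indices below n. *)
pose P q := (0 < q) && [forall i : 'I_n, u (i + q) == u i].
have perP q : P q <-> is_period u q.
  split=> [/andP[q0 /forallP uq]|[q0 uq]]; last first.
    by apply/andP; split=> //; apply/forallP => i; apply/eqP.
  split=> // i; rewrite (divn_eq i n) [_ * n + _]addnC addnAC.
  rewrite !(is_period_mul _ _ _ _ _ un).
  by move/eqP: (uq (Ordinal (ltn_pmod i n0))).
have exP : exists q, P q by exists n; apply/perP.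
have [p /perP up minp] := ex_minnP exP.
exists p; first by split=> // q /perP; exact: minp.
(* Otherwise the remainder of n modulo p would be a smaller period. *)
rewrite /dvdn; apply: contraT; rewrite -lt0n => r0.
have /perP/minp : is_period u (n %% p).
  split=> // i; rewrite -(is_period_mul _ _ _ (n %/ p) _ up) -addnA.
  by rewrite [n %% p + _]addnC -divn_eq unE.
by rewrite leqNgt ltn_pmod //; case: up.
Qed.

(** This criterion sees [b] only through its residue modulo [a]. *)
Lemma solvable0_modP (a b : nat) : odd a -> 1 < a -> 0 < b ->
  solvable 0 a b <-> exists2 t, t <= a./2 & b * t = a./2 %[mod a].
Proof.
move=> oa a1 b0; have a0 := ltnW a1.
have aE : a = a./2.*2.+1 by rewrite -[LHS]odd_double_half oa.
have N : (a.-1 * b.-1)./2 = a./2 * b.-1.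
  by rewrite {1}aE /= -doubleMl doubleK.
have h0 : 0 < a./2 by lia.
have ha : a./2 < a by lia.
split=> [/(solvableP _ a0 b0)[x [y]]|[t th bt]].
  rewrite N add0n => e; have yh : y <= a./2 by nia.
  exists (a./2 - y); first by rewrite leq_subr.
  suff -> : b * (a./2 - y) = x * a + a./2 by rewrite modnMDl.
  by rewrite mulnBr; nia.
have hbt : a./2 <= b * t.
  rewrite leqNgt; apply/negP => lt; move: bt.
  by rewrite !modn_small //; lia.
move/eqP: bt; rewrite eqn_mod_dvd // => /dvdnP[k ek].
apply/(solvableP _ a0 b0); exists k, (a./2 - t).
by rewrite N add0n mulnBr mulnC -ek; nia.
Qed.

Lemma Gamma_eq_mod (a b c : nat) : odd a -> 1 < a -> 0 < b -> 0 < c ->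
  b = c %[mod a] -> Gamma a b = Gamma a c.
Proof.
move=> oa a1 b0 c0 bc; rewrite /Gamma.
suff -> : solvable 0 a b = solvable 0 a c by [].
apply/idP/idP => /(solvable0_modP _ _ oa a1) [//|t th e];
  apply/(solvable0_modP _ _ oa a1) => //; exists t => //; rewrite -e.
  by rewrite -modnMml -bc modnMml.
by rewrite -modnMml bc modnMml.
Qed.

Theorem theorem4p1 (a b : nat) (ha : 2 <= a) (hb : 2 <= b)
    (hab : coprime a b) (ha_odd : odd a) :
  exists2 p : nat,
    least_period (fun i : nat => Gamma a (b ^ i.+1)) p & p %| mult_order a b.
Proof.
have b0 := ltnW hb.
apply: least_period_dvd; split=> [|i]; first exact: order_gt0.
apply: Gamma_eq_mod; rewrite ?expn_gt0 ?b0 //.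
have /eqP e : b ^ mult_order a b == 1 %[mod a] by rewrite -mult_order_dvd.
by rewrite -addSn expnD -modnMmr e modnMmr muln1.
Qed.
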